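(* Let $\|\cdot\|$ be a norm on $\mathbb{R}^d$ with closed unit ball $\mathcal{B}$, and let $X$ be a random vector in $\mathbb{R}^d$. For $u\in\mathbb{R}^d$ and $p\ge 1$ let $M_X(u,p)=\mathbb{E}\left(|\langle u,X\rangle|^p\right)\in[0,\infty]$. For a Borel probability measure $\mathbb{P}_0$ on $\mathbb{R}^d$ let $\mathbb{E}_0$ denote expectation with respect to $U\sim\mathbb{P}_0$ and let $$\nu(\mathbb{P}_0)=\sup_{x\in\partial\mathcal{B}}\frac{1}{\mathbb{P}_0\left(|\langle U,x\rangle|\ge 1\right)}\in[1,\infty].$$ Then for every $p\ge 1$ and every Borel probability measure $\mathbb{P}_0$ on $\mathbb{R}^d$, $$\mathbb{E}\left(\|X\|^p\right)\le \mathbb{E}_0\left(M_X(U,p)\right)\,\nu(\mathbb{P}_0).$$ Furthermore, for any $t\ge 0$, with probability at least $1-e^{-t}$, $$\|X\|\le \inf_{p\ge 1,\ \mathbb{P}_0} e^{t/p}\left(\mathbb{E}_0\left(M_X(U,p)\right)\right)^{1/p}\nu^{1/p}(\mathbb{P}_0),$$ where the infimum is over all $p\ge1$ and all Borel probability measures $\mathbb{P}_0$ on $\mathbb{R}^d$.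
   Context: $\langle\cdot,\cdot\rangle$ is the standard inner product on $\mathbb{R}^d$; $\partial\mathcal{B}$ is the boundary of $\mathcal{B}$, i.e. $\{x:\|x\|=1\}$. Quantities take values in $[0,\infty]$ with the conventions $1/0=\infty$ and $0\cdot\infty=\infty$ (so the bounds are vacuous when $\nu(\mathbb{P}_0)=\infty$). *)

(* Defs.v *)
(* MathComp-Analysis; the reals are an arbitrary R : realType. *)
From HB Require Import structures.
From mathcomp Require Import all_boot all_order all_algebra.
From mathcomp Require Import all_classical all_reals all_analysis.

Set Implicit Arguments.
Unset Strict Implicit.
Unset Printing Implicit Defensive.

Import Order.TTheory GRing.Theory Num.Theory.
Import numFieldNormedType.Exports.

Local Open Scope classical_set_scope.
Local Open Scope ring_scope.

(* Nonnegativity and N 0 = 0 follow from these axioms.  N is arbitrary: it is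
   unrelated to the library's sup norm on row vectors, which only serves to
   define the usual topology. *)
Record is_norm (R : realType) (d : nat) (N : 'rV[R]_d -> R) : Prop := IsNorm {
  is_norm_triangle : forall x y, N (x + y) <= N x + N y ;
  is_norm_scale : forall (a : R) x, N (a *: x) = `|a| * N x ;
  is_norm_eq0 : forall x, N x = 0 -> x = 0 }.

(* R^d with its Borel sigma-algebra. *)
Definition borelRd (R : realType) (d : nat) : measurableType _ :=
  g_sigma_algebraType (@open 'rV[R]_d).

Definition dot (R : realType) (d : nat) (u v : 'rV[R]_d) : R :=
  \sum_(i < d) u ord0 i * v ord0 i.

(* Product in [0, +oo] with 0 * +oo = +oo, whereas the library's product has
   0 * +oo = 0.  The library's inverse already satisfies 0^-1 = +oo. *)
Definition muley (R : realType) (x y : \bar R) : \bar R :=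
  (if ((x == 0) && (y == +oo)) || ((x == +oo) && (y == 0))
   then +oo else x * y)%E.

(* M_X(u, p) = E(|<u, X>|^p) *)
Definition moment (R : realType) (d : nat) (dT : measure_display)
    (T : measurableType dT) (P : probability T R) (X : {RV P >-> borelRd R d})
    (u : borelRd R d) (p : R) : \bar R :=
  ('E_P[fun w => (`|dot u (X w)| `^ p)%R])%E.

(* E_0(M_X(U, p)) for U distributed according to P0 *)
Definition mean_moment (R : realType) (d : nat) (dT : measure_display)
    (T : measurableType dT) (P : probability T R) (X : {RV P >-> borelRd R d})
    (p : R) (P0 : probability (borelRd R d) R) : \bar R :=
  (\int[P0]_u moment X u p)%E.

(* For d = 0 the unit sphere is empty and this is the supremum of the empty
   set, -oo; for d > 0 it lies in [1, +oo]. *)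
Definition nu (R : realType) (d : nat) (N : 'rV[R]_d -> R)
    (P0 : probability (borelRd R d) R) : \bar R :=
  ereal_sup [set ((P0 [set u | (1 <= `|dot u x|)%R])^-1)%E
            | x in [set x : 'rV[R]_d | N x = 1]].

Definition tail_bound (R : realType) (d : nat) (N : 'rV[R]_d -> R)
    (dT : measure_display) (T : measurableType dT) (P : probability T R)
    (X : {RV P >-> borelRd R d}) (t p : R)
    (P0 : probability (borelRd R d) R) : \bar R :=
  muley (muley (expR (t / p))%:E (poweR (mean_moment X p P0) p^-1))
        (poweR (nu N P0) p^-1).

(* Main.v *)
(* If N y = 1, Markov's inequality gives P0(|<U,y>| >= 1) <= E_0 |<U,y>|^p, so
   1 <= nu(P0) E_0 |<U,y>|^p, and by homogeneity
   N(x)^p <= nu(P0) E_0 |<U,x>|^p for every x.  Put x = X, integrate over P and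
   exchange the integrals by Tonelli.  For the tail, Markov's inequality bounds
   P(N X >= c) by e^-t as soon as c exceeds one of the tail bounds, hence as soon
   as c exceeds their infimum b; then let c decrease to b. *)
Require Import Defs.
From HB Require Import structures.
From mathcomp Require Import all_boot all_order all_algebra.
From mathcomp Require Import all_classical all_reals all_analysis.
From mathcomp Require Import measurable_realfun.

Set Implicit Arguments.
Unset Strict Implicit.
Unset Printing Implicit Defensive.

Import Order.TTheory GRing.Theory Num.Theory.
Import numFieldNormedType.Exports.

Local Open Scope classical_set_scope.
Local Open Scope ring_scope.

(** * Borel measurability on R^d *)

Lemma borelRd_continuous_measurable (R : realType) (d : nat)
    (f : 'rV[R]_d -> R) :
  continuous f -> measurable_fun setT (f : borelRd R d -> R).
Proof.
(* Open intervals generate the Borel sets of [R]; their preimages under [f] are open, hence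
   generators of [borelRd]. *)
move=> /continuousP cf; apply: (measurability _ (RGenOpens.measurableE R)).
move=> _ [_ [a [b ->] <-]]; rewrite setTI.
by apply: sub_sigma_algebra; apply: cf; exact: interval_open.
Qed.

Lemma measurable_coord (R : realType) (d : nat) (i : 'I_d) :
  measurable_fun setT (fun u : borelRd R d => u ord0 i : R).
Proof. by apply: borelRd_continuous_measurable; exact: coord_continuous. Qed.

Lemma measurable_dot (R : realType) (d : nat) (dT : measure_display)
    (T : measurableType dT) (f g : T -> borelRd R d) :
  measurable_fun setT f -> measurable_fun setT g ->
  measurable_fun setT (fun w => dot (f w) (g w)).
Proof.
move=> mf mg; apply: measurable_sum => i.
by apply: measurable_funM; apply: (measurableT_comp (measurable_coord i)).
Qed.

(** * Arbitrary norms on R^d and their continuity *)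

Lemma is_norm0 (R : realType) (d : nat) (N : 'rV[R]_d -> R) :
  is_norm N -> N 0 = 0.
Proof. by move=> hN; rewrite -(scale0r 0) (is_norm_scale hN) normr0 mul0r. Qed.

Lemma is_normN (R : realType) (d : nat) (N : 'rV[R]_d -> R) x :
  is_norm N -> N (- x) = N x.
Proof. by move=> hN; rewrite -scaleN1r (is_norm_scale hN) normrN1 mul1r. Qed.

Lemma is_norm_ge0 (R : realType) (d : nat) (N : 'rV[R]_d -> R) x :
  is_norm N -> 0 <= N x.
Proof.
move=> hN; have := is_norm_triangle hN x (- x).
by rewrite subrr is_norm0// is_normN// -mulr2n pmulrn_lge0.
Qed.

Lemma is_norm_sum (R : realType) (d : nat) (N : 'rV[R]_d -> R) (I : Type)
    (s : seq I) (f : I -> 'rV[R]_d) :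
  is_norm N -> N (\sum_(i <- s) f i) <= \sum_(i <- s) N (f i).
Proof.
move=> hN; elim/big_ind2: _ => [|x a y b xa yb|//]; first by rewrite is_norm0.
by rewrite (le_trans (is_norm_triangle hN _ _))// lerD.
Qed.

(** Expand [x] in the standard basis and bound each coordinate by the sup norm. *)
Lemma is_norm_le_mx_norm (R : realType) (d : nat) (N : 'rV[R]_d -> R) x :
  is_norm N -> N x <= (\sum_(i < d) N 'e_i) * `|x|.
Proof.
move=> hN; rewrite [in leLHS](row_sum_delta x) (le_trans (is_norm_sum _ _ hN))//.
rewrite mulr_suml; apply: ler_sum => i _.
rewrite (is_norm_scale hN) mulrC ler_wpM2l ?is_norm_ge0//.
by rewrite /Num.norm/= mx_normrE (le_bigmax _ _ (ord0, i)).
Qed.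

Lemma is_norm_dist (R : realType) (d : nat) (N : 'rV[R]_d -> R) x y :
  is_norm N -> `|N x - N y| <= N (x - y).
Proof.
move=> hN; have h1 := is_norm_triangle hN (y - x) x.
have h2 := is_norm_triangle hN (x - y) y.
rewrite !subrK -(opprB x y) is_normN// in h1 h2.
by rewrite ler_norml lerBlDr h2 andbT lerBrDl lerBlDl.
Qed.

(** By [is_norm_dist] and [is_norm_le_mx_norm], [N] is Lipschitz for the sup norm. Continuity is
    what makes [N] Borel measurable. *)
Lemma is_norm_continuous (R : realType) (d : nat) (N : 'rV[R]_d -> R) :
  is_norm N -> continuous N.
Proof.
move=> hN x; apply/(@cvgrPdist_lt _ _ _ (nbhs x) (nbhs_filter x)) => e e0.
set C := \sum_(i < d) N 'e_i.
have C0 : 0 <= C by apply: sumr_ge0 => i _; exact: is_norm_ge0.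
(* The [+ 1] keeps the divisor positive: [C] is an empty sum when [d = 0]. *)
have : \forall y \near x, `|x - y| < e / (C + 1).
  have /(@cvgrPdist_lt _ _ _ (nbhs x) (nbhs_filter x)) : y @[y --> x] --> x by exact: cvg_id.
  by apply; rewrite divr_gt0// ltr_wpDl.
apply: filterS => y; rewrite ltr_pdivlMr ?ltr_wpDl// => xy.
rewrite (le_lt_trans (is_norm_dist _ _ hN))//.
rewrite (le_lt_trans (is_norm_le_mx_norm _ hN))//.
by rewrite (le_lt_trans _ xy)// mulrC ler_wpM2l// lerDl.
Qed.

Lemma is_norm_normalize (R : realType) (d : nat) (N : 'rV[R]_d -> R) x :
  is_norm N -> x != 0 -> 0 < N x /\ N ((N x)^-1 *: x) = 1.
Proof.
move=> hN x0; have Nx0 : 0 < N x.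
  rewrite lt_neqAle is_norm_ge0// andbT eq_sym.
  by apply: contra x0 => /eqP/(is_norm_eq0 hN) ->.
by rewrite (is_norm_scale hN) ger0_norm ?invr_ge0 ?ltW// mulVf ?gt_eqF.
Qed.

(** * Markov's inequality and the product on [0, +oo] *)

Lemma measurable_superlevel (R : realType) (dT : measure_display)
    (T : measurableType dT) (f : T -> R) (c : R) :
  measurable_fun setT f -> measurable [set x | c <= f x].
Proof.
move=> mf; rewrite (_ : [set x | _] = f @^-1` `[c, +oo[%classic).
  by rewrite -[_ @^-1` _]setTI; apply: mf.
by apply/funext => x; rewrite /= in_itv/= andbT.
Qed.

Lemma markov_ge0 (R : realType) (dT : measure_display) (T : measurableType dT)
    (mu : {measure set T -> \bar R}) (g : T -> R) (c : R) :
  measurable_fun setT g -> (forall x, 0 <= g x) -> 0 < c ->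
  (c%:E * mu [set x | (c <= g x)%R] <= \int[mu]_x (g x)%:E)%E.
Proof.
move=> mg g0 c0.
have := @le_integral_comp_abse _ _ _ mu _ measurableT (EFin \o g) c id.
rewrite setTI; under eq_integral do rewrite /= ger0_norm//.
have -> : [set x | c%:E <= `|(EFin \o g) x|]%E = [set x | c <= g x].
  by apply/funext => x; rewrite /= ger0_norm// lee_fin.
apply => //.
exact/measurable_EFinP.
Qed.

(** The two products differ only where [muley] is [+oo], so upper bounds by the library's product
    transfer to [muley]. *)
Lemma muley_ge (R : realType) (x y : \bar R) : (x * y <= muley x y)%E.
Proof. by rewrite /muley; case: ifP => // _; exact: leey. Qed.

Lemma muley_ge0 (R : realType) (x y : \bar R) :
  (0 <= x -> 0 <= y -> 0 <= muley x y)%E.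
Proof. by move=> x0 y0; rewrite (le_trans _ (muley_ge _ _))// mule_ge0. Qed.

Lemma muleyy (R : realType) (x : \bar R) : (0 <= x)%E -> muley x +oo = +oo%E.
Proof.
rewrite /muley eqxx andbT le_eqVlt => /predU1P[<-|x0]; first by rewrite eqxx.
by case: ifP => // _; rewrite gt0_muley.
Qed.

Lemma muleyC (R : realType) (x y : \bar R) : muley x y = muley y x.
Proof. by rewrite /muley muleC orbC andbC [X in _ || X]andbC. Qed.

Lemma muley_fin (R : realType) (x y : R) : muley x%:E y%:E = (x * y)%:E.
Proof. by rewrite /muley !andbF/=. Qed.

(** * Pointwise control of the norm by [nu] *)

Lemma dotZr (R : realType) (d : nat) (a : R) (u x : 'rV[R]_d) :
  dot u (a *: x) = a * dot u x.
Proof.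
by rewrite /dot mulr_sumr; apply: eq_bigr => i _; rewrite mxE mulrCA.
Qed.

Lemma measurable_dot_powR (R : realType) (d : nat) (dT : measure_display)
    (T : measurableType dT) (f g : T -> borelRd R d) (p : R) :
  measurable_fun setT f -> measurable_fun setT g ->
  measurable_fun setT (fun w => `|dot (f w) (g w)| `^ p).
Proof.
move=> mf mg; apply: (measurableT_comp (measurable_powR p)).
apply: (measurableT_comp (@normr_measurable R setT)).
exact: measurable_dot.
Qed.

Lemma nu_inv_le (R : realType) (d : nat) (N : 'rV[R]_d -> R)
    (P0 : probability (borelRd R d) R) (x : 'rV[R]_d) :
  N x = 1 -> ((P0 [set u | (1 <= `|dot u x|)%R])^-1 <= nu N P0)%E.
Proof. by move=> Nx; apply: ereal_sup_ubound; exists x. Qed.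

(** The unit vector [x] rules out the supremum of the empty set, [-oo]. *)
Lemma nu_ge0 (R : realType) (d : nat) (N : 'rV[R]_d -> R)
    (P0 : probability (borelRd R d) R) (x : 'rV[R]_d) :
  N x = 1 -> (0 <= nu N P0)%E.
Proof. by move/(nu_inv_le P0); apply: le_trans; rewrite inve_ge0. Qed.

(* The hypothesis nu < +oo excludes the library's 0 * +oo = 0. *)
Lemma norm_powR_le_nu (R : realType) (d : nat) (N : 'rV[R]_d -> R)
    (P0 : probability (borelRd R d) R) (p : R) (x : 'rV[R]_d) :
  is_norm N -> 1 <= p -> (nu N P0 < +oo)%E ->
  ((N x `^ p)%:E <= nu N P0 * \int[P0]_u (`|dot u x| `^ p)%:E)%E.
Proof.
move=> hN p1 nufin; have p0 : 0 < p by rewrite (lt_le_trans _ p1).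
have [->|x0] := eqVneq x 0.
  rewrite is_norm0// powR0 ?gt_eqF// integral0_eq ?mule0// => u _.
  by rewrite -(scale0r 0) dotZr mul0r normr0 powR0 ?gt_eqF.
have [Nx0] := is_norm_normalize hN x0.
set y := (N x)^-1 *: x => Ny.
have xE : x = N x *: y by rewrite /y scalerA divff ?gt_eqF// scale1r.
have mdot : measurable_fun setT (fun u : borelRd R d => `|dot u y| `^ p).
  by apply: measurable_dot_powR; [exact: measurable_id|exact: measurable_cst].
have -> : (\int[P0]_u (`|dot u x| `^ p)%:E =
           (N x `^ p)%:E * \int[P0]_u (`|dot u y| `^ p)%:E)%E.
  rewrite -ge0_integralZl_EFin ?powR_ge0//; last exact/measurable_EFinP.
  apply: eq_integral => u _.
  by rewrite [in LHS]xE dotZr normrM (gtr0_norm Nx0) powRM// ltW.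
rewrite muleCA -[leLHS]mule1 lee_wpmul2l ?lee_fin ?powR_ge0//.
pose A : set (borelRd R d) := [set u | 1 <= `|dot u y|].
have nuA : ((P0 A)^-1 <= nu N P0)%E by exact: nu_inv_le.
(* [P0 A = 0] would make its inverse, and with it [nu], equal to [+oo]. *)
have PA0 : P0 A != 0%E.
  by apply/eqP => PA0; move: nuA; rewrite PA0 inve0 leye_eq => /eqP nuy;
    rewrite nuy ltxx in nufin.
have mA : measurable A.
  apply: measurable_superlevel.
  apply: (measurableT_comp (@normr_measurable R setT)).
  by apply: measurable_dot; [exact: measurable_id|exact: measurable_cst].
have PAfin : P0 A \is a fin_num by rewrite fin_num_measure.
(* Write 1 as [(P0 A)^-1 * P0 A] and compare factor by factor; the second comparison is Markov's
   inequality for the [p]-th power at level 1. *)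
rewrite -(mulVe PA0 PAfin) lee_pmul// ?inve_ge0//.
have mB : measurable [set u : borelRd R d | 1 <= `|dot u y| `^ p].
  exact: measurable_superlevel.
have := @markov_ge0 _ _ _ P0 _ 1 mdot; rewrite mul1e.
move=> /(_ (fun=> powR_ge0 _ _) ltr01); apply: le_trans.
apply: le_measure; rewrite ?inE// => u /= uA.
rewrite [leLHS](_ : 1 = 1 `^ p); last by rewrite powR1.
by rewrite ge0_ler_powR ?nnegrE// ltW.
Qed.

(** * The moment inequality *)

Lemma is_norm_measurable (R : realType) (d : nat) (N : 'rV[R]_d -> R)
    (dT : measure_display) (T : measurableType dT) (P : probability T R)
    (X : {RV P >-> borelRd R d}) :
  is_norm N -> measurable_fun setT (fun w => N (X w)).
Proof.
move=> hN; apply: (measurableT_comp _ (measurable_funPT X)).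
by apply: borelRd_continuous_measurable; exact: is_norm_continuous.
Qed.

(** Tonelli's theorem for a nonnegative, jointly measurable integrand. The inner integral becomes
    the one that [norm_powR_le_nu] handles at [x = X w]. *)
Lemma mean_momentE (R : realType) (d : nat) (dT : measure_display)
    (T : measurableType dT) (P : probability T R) (X : {RV P >-> borelRd R d})
    (p : R) (P0 : probability (borelRd R d) R) :
  mean_moment X p P0 =
  (\int[P]_w \int[P0]_u (`|dot u (X w)| `^ p)%:E)%E.
Proof.
rewrite /mean_moment /moment; under eq_integral do rewrite unlock.
rewrite (fubini_tonelli (fun z : borelRd R d * T => (`|dot z.1 (X z.2)| `^ p)%:E))//.
apply/measurable_EFinP/measurable_dot_powR; first exact: measurable_fst.
exact: (measurableT_comp (measurable_funPT X) measurable_snd).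
Qed.

Lemma expectation_norm_powR_le (R : realType) (d : nat) (N : 'rV[R]_d -> R)
    (dT : measure_display) (T : measurableType dT) (P : probability T R)
    (X : {RV P >-> borelRd R d}) (p : R) (P0 : probability (borelRd R d) R) :
  is_norm N -> 1 <= p ->
  ('E_P[fun w => (N (X w) `^ p)%R] <= muley (mean_moment X p P0) (nu N P0))%E.
Proof.
move=> hN p1; have p0 : 0 < p by rewrite (lt_le_trans _ p1).
have mX : measurable_fun setT X by exact: measurable_funPT.
have I0 w : (0 <= \int[P0]_u (`|dot u (X w)| `^ p)%:E)%E.
  by apply: integral_ge0 => u _; rewrite lee_fin powR_ge0.
have M0 : (0 <= mean_moment X p P0)%E.
  by rewrite mean_momentE; exact: integral_ge0.
have [->|nufin] := eqVneq (nu N P0) +oo%E; first by rewrite muleyy// leey.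
rewrite (le_trans _ (muley_ge _ _))// muleC.
(* An empty unit sphere (d = 0) gives nu = -oo, but then X = 0. *)
have [[y Ny]|noy] := pselect (exists y, N y = 1); last first.
  have X0 w : X w = 0.
    apply: contrapT => /eqP /(is_norm_normalize hN)[_ Ny].
    by apply: noy; exists ((N (X w))^-1 *: X w).
  rewrite unlock integral0_eq => [|w _]; last first.
    by rewrite X0 is_norm0// powR0 ?gt_eqF.
  rewrite mean_momentE integral0_eq ?mule0// => w _.
  rewrite integral0_eq// => u _.
  by rewrite X0 -(scale0r 0) dotZr mul0r normr0 powR0 ?gt_eqF.
have mI : measurable_fun setT
    (fun w => \int[P0]_u (`|dot u (X w)| `^ p)%:E)%E.
  apply: (measurable_fun_fubini_tonelli_F
           (fun z : T * borelRd R d => (`|dot z.2 (X z.1)| `^ p)%:E)).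
    apply/measurable_EFinP/measurable_dot_powR; first exact: measurable_snd.
    exact: (measurableT_comp mX measurable_fst).
  by move=> z; rewrite lee_fin powR_ge0.
(* The unit vector [y] gives [0 <= nu], so [nu] may enter the integral as a constant; the comparison
   is then pointwise. *)
rewrite mean_momentE unlock -ge0_integralZl//; last exact: (nu_ge0 P0 Ny).
apply: ge0_le_integral => //.
- by move=> w _; rewrite lee_fin powR_ge0.
- apply/measurable_EFinP/(measurableT_comp (measurable_powR p)).
  exact: is_norm_measurable.
- exact: measurable_funeM.
- by move=> w _; apply: norm_powR_le_nu => //; rewrite ltey.
Qed.

(** * The tail estimate *)

Lemma tail_bound_ge0 (R : realType) (d : nat) (N : 'rV[R]_d -> R)
    (dT : measure_display) (T : measurableType dT) (P : probability T R)
    (X : {RV P >-> borelRd R d}) (t p : R)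
    (P0 : probability (borelRd R d) R) : (0 <= tail_bound N X t p P0)%E.
Proof. by rewrite !muley_ge0 ?poweR_ge0// lee_fin expR_ge0. Qed.

(** Markov's inequality for [N (X w)]^ p[at level]c [^ p], combined with the moment inequality. *)
Lemma tail_bound_lt (R : realType) (d : nat) (N : 'rV[R]_d -> R)
    (dT : measure_display) (T : measurableType dT) (P : probability T R)
    (X : {RV P >-> borelRd R d}) (t p c : R)
    (P0 : probability (borelRd R d) R) :
  is_norm N -> 1 <= p -> 0 < c -> (tail_bound N X t p P0 < c%:E)%E ->
  (P [set w | (c <= N (X w))%R] <= (expR (- t))%:E)%E.
Proof.
move=> hN p1 c0 tc; have p0 : 0 < p by rewrite (lt_le_trans _ p1).
have M0 : (0 <= mean_moment X p P0)%E.
  rewrite mean_momentE; apply: integral_ge0 => w _.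
  by apply: integral_ge0 => u _; rewrite lee_fin powR_ge0.
(* Without unit vectors [X] vanishes, and [0 < c] makes the event empty. *)
have [[y Ny]|noy] := pselect (exists y, N y = 1); last first.
  rewrite (_ : [set w | _] = set0) ?measure0 ?lee_fin ?expR_ge0//.
  apply/seteqP; split=> // w /= cN; apply: noy.
  exists ((N (X w))^-1 *: X w).
  have [|//] := @is_norm_normalize _ _ N (X w) hN.
  by apply: contraTneq cN => ->; rewrite is_norm0// -ltNge.
have n0 := nu_ge0 P0 Ny.
have MB := expectation_norm_powR_le X P0 hN p1.
move: tc MB M0 n0; rewrite /tail_bound.
have pV0 : p^-1 != 0 by rewrite invr_eq0 gt_eqF.
have e0 : (0 <= (expR (t / p))%:E)%E by rewrite lee_fin expR_ge0.
(* By the convention [0 * +oo = +oo], an infinite [nu] or moment forces the tail bound to be [+oo],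
   which is not below [c]. Afterwards [n] and [m] are real. *)
case: (nu N P0) => [n| |//]; last first.
  by move=> + _ _ _; rewrite poweRyr// muleyy ?muley_ge0 ?poweR_ge0// ltNge leey.
case: (mean_moment X p P0) => [m| |//]; last first.
  by move=> + _ _ _; rewrite poweRyr// muleyy// muleyC muleyy ?poweR_ge0// ltNge leey.
rewrite !poweR_EFin !muley_fin lte_fin !lee_fin => tc MB m0 n0.
(* The left-hand side is the [p]-th power of the tail bound. *)
have mnc : expR t * (m * n) <= c `^ p.
  have -> : expR t * (m * n) = (expR (t / p) * m `^ p^-1 * n `^ p^-1) `^ p.
    rewrite !powRM ?mulr_ge0 ?powR_ge0 ?expR_ge0// -expRM -!powRrM.
    by rewrite divfK ?mulVf ?gt_eqF// !powRr1// mulrA.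
  by rewrite ge0_ler_powR ?nnegrE ?(ltW p0) ?(ltW c0) ?(ltW tc)// !mulr_ge0
             ?powR_ge0 ?expR_ge0.
have mN := is_norm_measurable X hN.
have cp0 : 0 < c `^ p by exact: powR_gt0.
pose A := [set w | c <= N (X w)].
have mA : measurable A by exact: measurable_superlevel.
have PAfin : P A \is a fin_num by exact: fin_num_measure.
have : ((c `^ p)%:E * P A <= (m * n)%:E)%E.
  (* The two events agree because the [p]-th power is strictly increasing on nonnegative reals. *)
  rewrite (_ : A = [set w | c `^ p <= N (X w) `^ p]).
    apply: le_trans (MB); rewrite unlock; apply: markov_ge0 => //.
    - exact: (measurableT_comp (measurable_powR p) mN).
    - by move=> w; exact: powR_ge0.
  apply/seteqP; split => w /=.
    by move=> ?; rewrite ge0_ler_powR ?nnegrE ?(ltW p0) ?(ltW c0) ?is_norm_ge0.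
  apply: contraLR; rewrite -!ltNge => ?.
  by rewrite gt0_ltr_powR ?nnegrE ?(ltW c0) ?is_norm_ge0.
rewrite -/A; case: (P A) PAfin => // r _; rewrite -EFinM !lee_fin => PA.
rewrite -(ler_pM2l cp0) (le_trans PA)// expRN ler_pdivlMr ?expR_gt0//.
by rewrite mulrC.
Qed.

(** For finite [b], the event that [N (X w)] exceeds [b] is the increasing union of the events
    [F k], each of probability at most [q]; continuity from below carries the bound to the union. *)
Lemma probability_norm_le (R : realType) (d : nat) (N : 'rV[R]_d -> R)
    (dT : measure_display) (T : measurableType dT) (P : probability T R)
    (X : {RV P >-> borelRd R d}) (q : R) (b : \bar R) :
  is_norm N -> 0 <= q -> (0 <= b)%E ->
  (forall c : R, (b < c%:E)%E -> (P [set w | (c <= N (X w))%R] <= q%:E)%E) ->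
  ((1 - q)%:E <= P [set w | ((N (X w))%:E <= b)%E])%E.
Proof.
move=> hN q0; have mN := is_norm_measurable X hN.
case: b => [r| |//]; last first.
  move=> _ _; rewrite (_ : [set w | _] = setT) ?probability_setT ?lee_fin.
    by rewrite gerBl.
  by apply/seteqP; split=> // w _ /=; rewrite leey.
move=> r0 tail.
pose F k := [set w | r + k.+1%:R^-1 <= N (X w)].
have mF k : measurable (F k) by exact: measurable_superlevel.
have mU : measurable (\bigcup_k F k) by exact: bigcup_measurable.
have -> : [set w | ((N (X w))%:E <= r%:E)%E] = ~` (\bigcup_k F k).
  apply/seteqP; split => w /=.
    rewrite lee_fin => Nr [k _]; rewrite /F/= => rk.
    have := le_trans rk Nr; rewrite gerDl leNgt => /negP; apply.
    by rewrite invr_gt0.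
  move=> nF; rewrite lee_fin leNgt; apply/negP => /ltr_add_invr[k rk].
  by apply: nF; exists k => //; exact: ltW.
rewrite probability_setC// EFinB leeB//.
apply: (@cvge_le _ \oo _ _ (P \o F)).
  apply: nearW => k /=; apply: tail; rewrite lte_fin ltrDl invr_gt0//.
apply: nondecreasing_cvg_mu => // i j ij; apply/subsetPset => w.
rewrite /F/=; apply: le_trans; rewrite lerD2l lef_pV2 ?posrE// ler_nat.
exact: ij.
Qed.

Theorem lemma1 (R : realType) (d : nat) (N : 'rV[R]_d -> R) (hN : is_norm N)
    (dT : measure_display) (T : measurableType dT) (P : probability T R)
    (X : {RV P >-> borelRd R d}) :
  (forall (p : R) (P0 : probability (borelRd R d) R), 1 <= p ->
     ('E_P[fun w => (N (X w) `^ p)%R] <=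
        muley (mean_moment X p P0) (nu N P0))%E)
  /\
  (forall t : R, 0 <= t ->
     ((1 - expR (- t))%R%:E <=
        P [set w | (N (X w))%:E <=
             ereal_inf [set y | exists (p : R)
                                  (P0 : probability (borelRd R d) R),
                                  (1 <= p)%R /\ y = tail_bound N X t p P0]])%E).

Proof.
split=> [p P0 p1|t t0]; first exact: expectation_norm_powR_le.
apply: probability_norm_le ; rewrite ?expR_ge0//.
  by apply: le_ereal_inf_tmp => _ [p [P0 [_ ->]]]; exact: tail_bound_ge0.
(* A level [c] above the infimum already exceeds the tail bound of one pair [p], [P0], so the
   infinite family reduces to a single member for each [c]. *)
move=> c /ereal_inf_lt[_ [p [P0 [p1 ->]]] bc].
apply: (tail_bound_lt hN p1 _ bc).
(* Positivity of [c] comes from the nonnegative tail bound strictly below it. *)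
by rewrite -lte_fin (le_lt_trans _ bc)// tail_bound_ge0.
Qed.
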